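(* Let $I$ be a directed set, $X$ a cover space, and $Y$ a uniform space. Then a function $f : I \times X \to Y$ is a cover map if and only if the following conditions hold: (1) For every $n \in I$, the map $f(n,-) : X \to Y$ is a cover map. (2) For every uniform cover $D$ of $Y$, the set $\{U \subseteq X \mid \exists N \in I,\ \forall x \in U,\ \exists V \in D,\ \forall n \geq N,\ f(n,x) \in V\}$ is a Cauchy cover of $X$.
   Context: Conventions: constructive mathematics (internal language of an elementary topos). For subsets $U,V$ of a set, $U \between V$ means that there exists an element belonging to both. A cover of a set $X$ is a set $C$ of subsets of $X$ with $\bigcup C = X$; $C$ refines $D$ if every element of $C$ is a subset of some element of $D$. A precover space is a set $X$ with a collection $\mathcal{C}_X$ of covers of $X$ (called Cauchy covers) such that: (CT) $\{X\} \in \mathcal{C}_X$; (CE) if $C \in \mathcal{C}_X$ and $C$ refines $D$, then $D \in \mathcal{C}_X$; (CG) if $C \in \mathcal{C}_X$ and $D_U \in \mathcal{C}_X$ for every $U \in C$, then $\{U \cap V \mid U \in C, V \in D_U\} \in \mathcal{C}_X$. It is a cover space if moreover (CR) for $C \in \mathcal{C}_X$, $\{V \subseteq X \mid \exists U \in C,\ V \prec_X U\} \in \mathcal{C}_X$, where $V \prec_X U$ means $\{W \subseteq X \mid W \between V \Rightarrow W \subseteq U\} \in \mathcal{C}_X$. A cover map $f : X \to Y$ is a function such that for every Cauchy cover $D$ of $Y$, $\{f^{-1}(V) \mid V \in D\}$ is a Cauchy cover of $X$. The product $X \times X'$ of cover spaces carries the smallest collection of covers closed under (CT), (CE), (CG)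 containing all $\{\pi_1^{-1}(U) \mid U \in C\}$ and $\{\pi_2^{-1}(U') \mid U' \in C'\}$ with $C$, $C'$ Cauchy covers of $X$, $X'$ respectively. A uniform space is a set $Y$ with a collection $\mathcal{U}_Y$ of covers (uniform covers) such that: $\{Y\} \in \mathcal{U}_Y$; if $C \in \mathcal{U}_Y$ refines $D$ then $D \in \mathcal{U}_Y$; if $C,D \in \mathcal{U}_Y$ then $\{U \cap V \mid U \in C, V \in D\} \in \mathcal{U}_Y$; and for every $C \in \mathcal{U}_Y$ there exists $D \in \mathcal{U}_Y$ such that for every $V \in D$ there exists $U \in C$ such that every $W \in D$ satisfies $W \between V \Rightarrow W \subseteq U$. A uniform space is regarded as a cover space whose Cauchy covers form the smallest collection containing $\mathcal{U}_Y$ and closed under (CT), (CE), (CG). A directed set $I$ is a preordered set in which every finite subset has an upper bound; $I_{\geq N} = \{n \in I \mid n \geq N\}$. The precover space structure on $I$ has as Cauchy covers those covers $C$ for which there exist $U \in C$ and $N \in I$ with $I_{\geq N} \subseteq U$. The cover space structure on $I$ (used in the product $I \times X$) is its reflection: the largest cover space structure contained in this precover structure, i.e. the closure under (CT), (CE), (CG) of the union of all cover space structures on $I$ contained in it. *)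

(* Defs.v *)
From Corelib Require Import RelationClasses.
From Stdlib Require List.
From mathcomp Require Import all_boot all_classical.

Set Implicit Arguments.
Unset Strict Implicit.
Unset Printing Implicit Defensive.

Local Open Scope classical_set_scope.

(* All notions are stated with Prop-valued sets and relations only: the
   definitions themselves use no classical axiom. *)

Definition covers (X : Type) (C : set_system X) : Prop :=
  \bigcup_(U in C) U = [set: X].

Definition refines (X : Type) (C D : set_system X) : Prop :=
  forall U, C U -> exists2 V, D V & U `<=` V.

Definition meets (X : Type) (U V : set X) : Prop := U `&` V !=set0.

(* [CX] is the collection of Cauchy covers.  In [precover_inter] the family
   [D] is total, but its values outside [C] are unconstrained and unused. *)
Record precover_space (X : Type) (CX : set (set_system X)) : Prop :=
  PrecoverSpace {
  precover_covers : forall C, CX C -> covers C;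
  precover_setT : CX [set [set: X]];
  precover_refines : forall C D, CX C -> refines C D -> CX D;
  precover_inter : forall (C : set_system X) (D : set X -> set_system X),
    CX C -> (forall U, C U -> CX (D U)) ->
    CX (\bigcup_(U in C) [set U `&` V | V in D U])
}.

Definition strongly_below (X : Type) (CX : set (set_system X))
    (V U : set X) : Prop :=
  CX [set W | meets W V -> W `<=` U].

Record cover_space (X : Type) (CX : set (set_system X)) : Prop := CoverSpace {
  cover_precover : precover_space CX;
  cover_regular : forall C, CX C ->
    CX [set V | exists2 U, C U & strongly_below CX V U]
}.

Definition cover_map (X Y : Type) (CX : set (set_system X))
    (CY : set (set_system Y)) (f : X -> Y) : Prop :=
  forall D, CY D -> CX [set f @^-1` V | V in D].

(* The smallest collection of covers containing [B] and closed under the three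
   precover operations; meaningful when the elements of [B] are covers. *)
Definition generated_precover (X : Type) (B : set (set_system X)) :
    set (set_system X) :=
  smallest (@precover_space X) B.

Definition product_cauchy (X X' : Type) (CX : set (set_system X))
    (CX' : set (set_system X')) : set (set_system (X * X')) :=
  generated_precover
    ([set [set fst @^-1` U | U in C] | C in CX] `|`
     [set [set snd @^-1` U | U in C] | C in CX']).

Record uniform_space (Y : Type) (UY : set (set_system Y)) : Prop :=
  UniformSpace {
  uniform_covers : forall C, UY C -> covers C;
  uniform_setT : UY [set [set: Y]];
  uniform_refines : forall C D, UY C -> refines C D -> UY D;
  uniform_inter : forall C D, UY C -> UY D ->
    UY [set U `&` V | U in C & V in D];
  uniform_star : forall C, UY C -> exists2 D, UY D &
    forall V, D V -> exists2 U, C U &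
      forall W, D W -> meets W V -> W `<=` U
}.

Definition uniform_cauchy (Y : Type) (UY : set (set_system Y)) :
    set (set_system Y) :=
  generated_precover UY.

(* Finite subsets are those enumerated by a list (Kuratowski finiteness); the
   empty list makes a directed set inhabited. *)
Record directed_set (I : Type) (le : I -> I -> Prop) : Prop := DirectedSet {
  directed_preorder : PreOrder le;
  directed_upper_bound : forall s : seq I,
    exists N, forall n, List.In n s -> le n N
}.

Definition directed_precauchy (I : Type) (le : I -> I -> Prop) :
    set (set_system I) :=
  [set C | covers C /\ exists U N, C U /\ [set n | le N n] `<=` U].

Definition cover_reflection (X : Type) (P : set (set_system X)) :
    set (set_system X) :=
  generated_precover
    (\bigcup_(S in [set S | cover_space S /\ S `<=` P]) S).

Definition directed_cauchy (I : Type) (le : I -> I -> Prop) :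
    set (set_system I) :=
  cover_reflection (directed_precauchy le).

(* Main.v *)
Require Import Defs.
From Corelib Require Import RelationClasses.
From mathcomp Require Import all_boot all_classical.
Local Open Scope classical_set_scope.

(** The easy half of the equivalence is a computation on generators.  Say that
    a cover [E] of [I * X] is eventually uniform when the sets [U] such that a
    whole tail strip [{n | N <= n} * U] lies in one member of [E] form a Cauchy
    cover of [X].  These covers form a precover structure
    ([precover_tail_strip]) containing the generators of the product, hence all
    Cauchy covers of the product, in particular the preimages under [f] of
    uniform covers; this is even stronger than condition (2), because the
    member of [D] does not depend on the point of [U].

    For the converse, the dependence on the point is removed by a star
    refinement [E] of [D].  Let [U] and [N] be as in (2) for [E].  If [m] and
    [n] are both beyond [N], or are equal, then for every [x] in [U] some member
    of [E] contains both [f (m, x)] and [f (n, x)].  So if [x] also lies in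
    [f (n, -)^-1 V'] with [V'] in [E], then [f (m, x)] lies in the star of [V'],
    which is contained in one member of [D].  The sets [f (n, -)^-1 V'] form a
    Cauchy cover by (1).  What remains is that the classes of the relation
    `equal, or both beyond [N]' form a Cauchy cover of [I]
    ([tail_classes_cauchy]): the covers refined by the classes of an equivalence
    relation always form a cover space, and here one class contains a tail.
    Gluing these local refinements ([precover_local]) shows that the preimage of
    [D] is Cauchy. *)

(** * Precover structures *)

(** Being Cauchy is a local property.  Stating the local condition with the
    largest candidate for the cover over [U], rather than with the existence of
    some Cauchy cover, lets (CG) apply without choosing one cover for each
    [U]. *)
Lemma precover_local {X : Type} {CX : set (set_system X)} {C E : set_system X} :
  precover_space CX -> CX C ->
  (forall U, C U -> CX [set V | exists2 W, E W & U `&` V `<=` W]) -> CX E.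
Proof.
move=> hX CC CD.
apply: (precover_refines hX (precover_inter hX CC CD) _).
by move=> _ [U CU [V [W EW UVW] <-]]; exists W.
Qed.

Lemma generated_precover_sub {X : Type} {B S : set (set_system X)} :
  precover_space S -> B `<=` S -> generated_precover B `<=` S.
Proof. by move=> hS BS; apply: smallest_sub. Qed.

Lemma generated_precover_incl {X : Type} {B : set (set_system X)} :
  B `<=` generated_precover B.
Proof. exact: sub_smallest. Qed.

Lemma precover_all_covers (X : Type) : precover_space (@covers X).
Proof.
split=> //.
- by apply/seteqP; split=> // x _; exists setT.
- move=> C D CC CD; apply/seteqP; split=> // x _.
  have [U CU Ux] : (\bigcup_(U in C) U) x by rewrite CC.
  by have [V DV UV] := CD _ CU; exists V => //; apply: UV.
- move=> C D CC DC; apply/seteqP; split=> // x _.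
  have [U CU Ux] : (\bigcup_(U in C) U) x by rewrite CC.
  have [V DV Vx] : (\bigcup_(V in D U) V) x by rewrite (DC _ CU).
  by exists (U `&` V) => //; exists U => //; exists V.
Qed.

Lemma generated_precover_space {X : Type} {B : set (set_system X)} :
  B `<=` @covers X -> precover_space (generated_precover B).
Proof.
move=> BC; split.
- exact: (generated_precover_sub (precover_all_covers X) BC).
- by move=> S [hS _]; exact: (precover_setT hS).
- move=> C D GC CD S [hS BS].
  by apply: (precover_refines hS (GC S (conj hS BS)) CD).
- move=> C D GC GD S [hS BS].
  apply: (precover_inter hS (GC S (conj hS BS)) _).
  by move=> U CU; exact: (GD U CU S (conj hS BS)).
Qed.

(** The covers whose preimages are Cauchy form a precover structure, so they
    contain everything that they generate. *)
Lemma cover_map_generated {X Y : Type} {CX : set (set_system X)}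
    (B : set (set_system Y)) (f : X -> Y) :
  precover_space CX -> B `<=` @covers Y ->
  (forall D, B D -> CX [set f @^-1` V | V in D]) ->
  cover_map CX (generated_precover B) f.
Proof.
move=> hX BC Bf D GD.
pose S := [set D | covers D /\ CX [set f @^-1` V | V in D]].
suff hS : precover_space S.
  have BS : B `<=` S by move=> E BE; split; [apply: BC | apply: Bf].
  by have [] := generated_precover_sub hS BS _ GD.
have hA := precover_all_covers Y.
split.
- by move=> C [].
- split; first exact: (precover_setT hA).
  apply: (precover_refines hX (precover_setT hX) _) => _ ->.
  by exists setT => //; exists setT.
- move=> C E [cC CC] CE; split; first exact: (precover_refines hA cC CE).
  apply: (precover_refines hX CC _) => _ [U CU <-].
  have [V EV UV] := CE _ CU.
  by exists (f @^-1` V); [exists V | move=> x; apply: UV].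
- move=> C E [cC CC] CE; split.
    by apply: (precover_inter hA cC _) => U /CE[].
  apply: (precover_local hX CC _) => _ [U CU <-].
  have [_ CEU] := CE _ CU.
  apply: (precover_refines hX CEU _) => _ [V EV <-].
  exists (f @^-1` V) => //; exists (f @^-1` (U `&` V)) => //.
  by exists (U `&` V) => //; exists U => //; exists V.
Qed.

(** * Products *)

Section Product.
Context {X X' : Type} {CX : set (set_system X)} {CX' : set (set_system X')}.
Hypotheses (cX : CX `<=` @covers X) (cX' : CX' `<=` @covers X').

Lemma product_generator_covers :
  [set [set fst @^-1` U | U in C] | C in CX] `|`
  [set [set snd @^-1` U | U in C] | C in CX'] `<=` @covers (X * X').
Proof.
move=> _ [[C CC <-]|[C CC <-]]; apply/seteqP; split=> // -[x x'] _.
- have [U CU Ux] : (\bigcup_(U in C) U) x by rewrite (cX _ CC).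
  by exists (fst @^-1` U) => //; exists U.
- have [U CU Ux] : (\bigcup_(U in C) U) x' by rewrite (cX' _ CC).
  by exists (snd @^-1` U) => //; exists U.
Qed.

Lemma product_precover_space : precover_space (product_cauchy CX CX').
Proof. exact: (generated_precover_space product_generator_covers). Qed.

Lemma cover_map_fst : cover_map (product_cauchy CX CX') CX fst.
Proof. by move=> C CC; apply: generated_precover_incl; left; exists C. Qed.

Lemma cover_map_snd : cover_map (product_cauchy CX CX') CX' snd.
Proof. by move=> C CC; apply: generated_precover_incl; right; exists C. Qed.

Lemma cover_map_pair (a : X) :
  precover_space CX' -> cover_map CX' (product_cauchy CX CX') (pair a).
Proof.
move=> hX'; apply: cover_map_generated => //.
  exact: product_generator_covers.
move=> _ [[C CC <-]|[C CC <-]].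
- (* A member of [C] through [a] pulls back to the whole of [X']. *)
  have [U CU Ua] : (\bigcup_(U in C) U) a by rewrite (cX _ CC).
  apply: (precover_refines hX' (precover_setT hX') _) => _ ->.
  by exists (pair a @^-1` (fst @^-1` U)) => //; exists (fst @^-1` U) => //;
    exists U.
- apply: (precover_refines hX' CC _) => U CU.
  by exists (pair a @^-1` (snd @^-1` U)) => //; exists (snd @^-1` U) => //;
    exists U.
Qed.

End Product.

(** * Directed sets *)

Section Directed.
Context {I : Type} {le : I -> I -> Prop} (hI : directed_set le).

Lemma directed_inhabited : exists N : I, True.
Proof. by have [N _] := directed_upper_bound hI [::]; exists N. Qed.

Lemma directed_upper_bound2 (m n : I) : exists2 N, le m N & le n N.
Proof.
have [N ub] := directed_upper_bound hI [:: m; n].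
by exists N; apply: ub; [left | right; left].
Qed.

Lemma directed_le_refl (n : I) : le n n.
Proof. by have [r _] := directed_preorder hI; apply: r. Qed.

Lemma directed_le_trans {m n p : I} : le m n -> le n p -> le m p.
Proof. by have [_ t] := directed_preorder hI; apply: t. Qed.

Lemma directed_precauchy_precover : precover_space (directed_precauchy le).
Proof.
have hA := precover_all_covers I.
split.
- by move=> C [].
- split; first exact: (precover_setT hA).
  by have [N _] := directed_inhabited; exists setT, N.
- move=> C D [cC [U [N [CU NU]]]] CD.
  split; first exact: (precover_refines hA cC CD).
  by have [V DV UV] := CD _ CU; exists V, N; split=> // n /NU /UV.
- move=> C D [cC [U [N [CU NU]]]] CD; split.
    by apply: (precover_inter hA cC _) => V /CD[].
  have [_ [V [M [DV MV]]]] := CD _ CU.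
  have [K NK MK] := directed_upper_bound2 N M.
  exists (U `&` V), K; split; first by exists U => //; exists V.
  by move=> n /= Kn; split; [apply: NU | apply: MV];
    apply: directed_le_trans Kn.
Qed.

Lemma directed_cauchy_sub : directed_cauchy le `<=` directed_precauchy le.
Proof.
apply: (generated_precover_sub directed_precauchy_precover _).
by move=> C [S [_ SP] /SP].
Qed.

Lemma directed_cauchy_covers : directed_cauchy le `<=` @covers I.
Proof. by move=> C /directed_cauchy_sub[]. Qed.

End Directed.

(** An equivalence relation makes its underlying set a cover space because two
    classes that meet are equal, so that every class is strongly below every
    set containing it. *)
Lemma cover_space_of_equivalence {X : Type} (R : X -> X -> Prop) :
  Equivalence R ->
  cover_space [set C : set_system X | forall x, exists2 U, C U & R x `<=` U].
Proof.
move=> [r s t]; split; first split.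
- move=> C CC; apply/seteqP; split=> // x _.
  by have [U CU xU] := CC x; exists U => //; apply: xU; apply: r.
- by move=> x; exists setT.
- move=> C D CC CD x; have [U CU xU] := CC x.
  by have [V DV UV] := CD _ CU; exists V => // y /xU /UV.
- move=> C D CC CD x; have [U CU xU] := CC x; have [V DV xV] := CD _ CU x.
  exists (U `&` V); first by exists U => //; exists V.
  by move=> y xy; split; [apply: xU | apply: xV].
- move=> C CC x; have [U CU xU] := CC x; exists (R x) => //.
  exists U => // y; exists (R y) => // -[z [yz xz]] w yw; apply: xU.
  exact: (t _ _ _ xz (t _ _ _ (s _ _ yz) yw)).
Qed.

(** Morally the classes are the tail beyond [N] and the remaining single points;
    with classes indexed by their elements, they cover [I] without deciding
    whether an index is beyond [N].  The class of [N] contains the tail, so that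
    every cover refined by the classes has a member containing a tail. *)
Lemma tail_classes_cauchy {I : Type} {le : I -> I -> Prop}
    (hI : directed_set le) (N : I) :
  directed_cauchy le
    [set [set m | n = m \/ (le N n /\ le N m)] | n in [set: I]].
Proof.
pose R n m := n = m \/ (le N n /\ le N m).
have eqR : Equivalence R.
  split.
  - by move=> n; left.
  - by move=> n m [->|[]]; [left | right].
  - by move=> n m p [->//|[Nn Nm]] [<-|[_ Np]]; right.
apply: generated_precover_incl.
exists [set C : set_system I | forall n, exists2 U, C U & R n `<=` U]; last first.
  by move=> n; exists (R n) => //; exists n.
have hR := cover_space_of_equivalence _ eqR; split=> // C CC; split.
  exact: (precover_covers (cover_precover hR) CC).
have [U CU NU] := CC N; exists U, N; split=> // n Nn; apply: NU.
by right; split=> //; apply: directed_le_refl.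
Qed.

(** * Cauchy covers of the product with a directed set *)

(** Condition (2) is too weak to be carried through (CG): there the member of
    the cover varies with the point, and one would need a common bound for
    infinitely many of them.  Asking one member to contain the whole strip
    leaves only two bounds to combine. *)
Lemma precover_tail_strip {I X : Type} {le : I -> I -> Prop}
    {CX : set (set_system X)} :
  directed_set le -> precover_space CX ->
  precover_space [set E : set_system (I * X) | covers E /\
    CX [set U | exists N, exists2 W, E W &
          forall n x, le N n -> U x -> W (n, x)]].
Proof.
move=> hI hX; have hA := precover_all_covers (I * X).
split.
- by move=> E [].
- split; first exact: (precover_setT hA).
  apply: (precover_refines hX (precover_setT hX) _) => U _.
  have [N _] := directed_inhabited hI.
  by exists U => //; exists N, setT.
- move=> E F [cE CE] EF; split; first exact: (precover_refines hA cE EF).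
  apply: (precover_refines hX CE _) => U [N [W EW NUW]].
  have [W' FW' WW'] := EF _ EW.
  by exists U => //; exists N, W' => // n x Nn Ux; apply/WW'/NUW.
- move=> E F [cE CE] EF; split.
    by apply: (precover_inter hA cE _) => W /EF[].
  apply: (precover_local hX CE _) => U [N [W EW NUW]].
  have [_ CF] := EF _ EW.
  apply: (precover_refines hX CF _) => V [M [W' FW' MVW']].
  have [K NK MK] := directed_upper_bound2 hI N M.
  exists V => //; exists (U `&` V) => //.
  exists K, (W `&` W'); first by exists W => //; exists W'.
  move=> n x Kn [Ux Vx]; split.
  + by apply: NUW => //; apply: directed_le_trans Kn.
  + by apply: MVW' => //; apply: directed_le_trans Kn.
Qed.

Lemma product_cauchy_tail_strip {I X : Type} {le : I -> I -> Prop}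
    {CX : set (set_system X)} (E : set_system (I * X)) :
  directed_set le -> precover_space CX ->
  product_cauchy (directed_cauchy le) CX E ->
  CX [set U | exists N, exists2 W, E W &
        forall n x, le N n -> U x -> W (n, x)].
Proof.
move=> hI hX PE.
have gC := product_generator_covers (directed_cauchy_covers hI)
  (@precover_covers _ _ hX).
apply: (generated_precover_sub (precover_tail_strip hI hX) _ _ PE).2.
move=> F BF; split; first exact: gC.
case: BF => -[C CC <-].
- have [_ [U [N [CU NU]]]] := directed_cauchy_sub hI _ CC.
  apply: (precover_refines hX (precover_setT hX) _) => V _.
  exists V => //; exists N, (fst @^-1` U); first by exists U.
  by move=> n x Nn _; apply: NU.
- apply: (precover_refines hX CC _) => U CU.
  have [N _] := directed_inhabited hI.
  by exists U => //; exists N, (snd @^-1` U) => //; exists U.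
Qed.

(** The product is refined in three steps: over a set [U] of condition (2), then
    over the class of an index [n], then by the preimages of the star refinement
    under [f (n, -)].  Thus [n] serves as the reference index of its class, and
    [f (n, -)] has to be a cover map for every [n]. *)
Lemma uniform_preimage_cauchy {I X Y : Type} {le : I -> I -> Prop}
    {CX : set (set_system X)} {UY : set (set_system Y)} (f : I * X -> Y)
    (D : set_system Y) :
  directed_set le -> precover_space CX -> uniform_space UY ->
  (forall n, cover_map CX (uniform_cauchy UY) (fun x => f (n, x))) ->
  (forall E, UY E ->
     CX [set U : set X | exists N : I, forall x, U x ->
           exists2 V, E V & forall n, le N n -> V (f (n, x))]) ->
  UY D -> product_cauchy (directed_cauchy le) CX [set f @^-1` V | V in D].
Proof.
move=> hI hX hY fn fN UD.
have hP := product_precover_space (directed_cauchy_covers hI)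
  (@precover_covers _ _ hX).
have [E UE ED] := uniform_star hY UD.
apply: (precover_local hP (cover_map_snd _ (fN _ UE)) _) => _ [U [N UN] <-].
apply: (precover_local hP (cover_map_fst _ (tail_classes_cauchy hI N)) _).
move=> _ [_ [n _ <-] <-].
have CE := fn n _ (generated_precover_incl _ UE).
apply: (precover_refines hP (cover_map_snd _ CE) _) => _ [_ [V EV <-] <-].
have [W DW starW] := ED _ EV.
pose Vn : set (I * X) := snd @^-1` ((fun x => f (n, x)) @^-1` V).
exists Vn => //.
exists (fst @^-1` [set m | n = m \/ (le N n /\ le N m)] `&` Vn) => //.
exists (f @^-1` W); first by exists W.
move=> [m x] [/= Ux [nm Vnx]].
have [V' [EV' V'n V'm]] :
    exists V', [/\ E V', V' (f (n, x)) & V' (f (m, x))].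
  case: nm => [<-|[Nn Nm]].
  - have [V' EV' V'n] : (\bigcup_(V' in E) V') (f (n, x)).
      by rewrite (uniform_covers hY UE).
    by exists V'.
  - by have [V' EV' V'N] := UN _ Ux; exists V'; split=> //; apply: V'N.
by apply: (starW _ EV' _ _ V'm); exists (f (n, x)).
Qed.

(** * The characterization *)

Theorem proposition10p8
  (I : Type) (le : I -> I -> Prop) (hI : directed_set le)
  (X : Type) (CX : set (set_system X)) (hX : cover_space CX)
  (Y : Type) (UY : set (set_system Y)) (hY : uniform_space UY)
  (f : I * X -> Y) :
  cover_map (product_cauchy (directed_cauchy le) CX) (uniform_cauchy UY) f <->
  (forall n : I, cover_map CX (uniform_cauchy UY) (fun x => f (n, x))) /\
  (forall D : set_system Y, UY D ->
     CX [set U : set X | exists N : I, forall x, U x ->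
           exists2 V, D V & forall n, le N n -> V (f (n, x))]).
Proof.
have pX := cover_precover hX.
have cI := directed_cauchy_covers hI.
have cX : CX `<=` @covers X := @precover_covers _ _ pX.
split=> [hf|[fn fN]].
- split=> [n D /hf fD|D UD].
    have := cover_map_pair cI cX n pX _ fD; rewrite image_comp.
    exact.
  have fD := hf _ (generated_precover_incl _ UD).
  have CD := product_cauchy_tail_strip _ hI pX fD.
  apply: (precover_refines pX CD _) => U [N [_ [V DV <-] NUV]].
  by exists U => //; exists N => x Ux; exists V => // n Nn; apply: NUV.
- apply: cover_map_generated.
  + exact: product_precover_space.
  + exact: (uniform_covers hY).
  + by move=> D; apply: uniform_preimage_cauchy.
Qed.
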